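(* Let $N=1$ and consider the lattice Boltzmann scheme $\boldsymbol m^{n+1}=\boldsymbol A\boldsymbol m^n+\boldsymbol B\,\boldsymbol m^{\mathrm{eq}}|^n$ with linear equilibria, i.e. there is $\boldsymbol\epsilon\in\mathbb{R}^q$ such that $\boldsymbol m^{\mathrm{eq}}=\boldsymbol\epsilon\, m_1=(\boldsymbol\epsilon\otimes\boldsymbol e_1)\boldsymbol m$; it thus reads $\boldsymbol m^{n+1}=(\boldsymbol A+\boldsymbol B\boldsymbol\epsilon\otimes\boldsymbol e_1)\boldsymbol m^n$ with $\boldsymbol A+\boldsymbol B\boldsymbol\epsilon\otimes\boldsymbol e_1\in\mathcal{M}_q(\mathcal{D})$. Let $\chi_{\boldsymbol A}=\sum_{k=0}^q\gamma_kX^k$ and define $\Phi=\sum_{k=0}^q\varphi_kX^k\in\mathcal{D}[X]$ by $$\varphi_q=1,\qquad \varphi_k=\gamma_k-\left(\sum_{\ell=0}^{q-1-k}\gamma_{k+1+\ell}\,\boldsymbol A^{\ell}\boldsymbol B\,\boldsymbol\epsilon\otimes\boldsymbol e_1\right)_{11},\quad k\in\{0,\dots,q-1\}.$$ Then $$\Phi=\chi_{\boldsymbol A+\boldsymbol B\boldsymbol\epsilon\otimes\boldsymbol e_1}.$$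
   Context: Lattice and operators: $d\in\{1,2,3\}$, $\Delta x>0$, $\mathcal{L}=\Delta x\,\mathbb{Z}^d$. For $\boldsymbol z\in\mathbb{Z}^d$ the shift $T^{\boldsymbol z}$ acts on functions $f:\mathcal{L}\to\mathbb{R}$ by $(T^{\boldsymbol z}f)(\boldsymbol x)=f(\boldsymbol x-\boldsymbol z\Delta x)$. $\mathcal{D}$ denotes the commutative ring of Finite Difference operators, i.e. finite real linear combinations of shifts, with composition $T^{\boldsymbol z}\circ T^{\boldsymbol w}=T^{\boldsymbol z+\boldsymbol w}$ as product (the group ring $\mathbb{R}[\mathbb{Z}^d]$). Lattice Boltzmann scheme with one conserved moment ($N=1$): $q\ge 2$, velocities $\boldsymbol c_1,\dots,\boldsymbol c_q\in\mathbb{Z}^d$, an invertible moment matrix $\boldsymbol M\in\mathrm{GL}_q(\mathbb{R})$, a relaxation matrix $\boldsymbol S=\mathrm{diag}(0,s_2,\dots,s_q)$ with $s_i\in\,]0,2]$, and equilibria $\boldsymbol m^{\mathrm{eq}}:\mathbb{R}\to\mathbb{R}^q$. Put $\boldsymbol T=\boldsymbol M\,\mathrm{diag}(T^{\boldsymbol c_1},\dots,T^{\boldsymbol c_q})\boldsymbol M^{-1}$, $\boldsymbol A=\boldsymbol T(\boldsymbol I-\boldsymbol S)$, $\boldsymbol B=\boldsymbol T\boldsymbol S$ in $\mathcal{M}_q(\mathcal{D})$. The moments $\boldsymbol m^n=(m_1^n,\dots,m_q^n)^{\mathsf T}$, $m^n_j:\mathcal{L}\to\mathbb{R}$, evolve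 by $\boldsymbol m^{n+1}=\boldsymbol A\boldsymbol m^n+\boldsymbol B\,\boldsymbol m^{\mathrm{eq}}|^n$ with $\boldsymbol m^{\mathrm{eq}}|^n(\boldsymbol x)=\boldsymbol m^{\mathrm{eq}}(m_1^n(\boldsymbol x))$. The polynomial $\Phi$ is the amplification polynomial of the multi-step Finite Difference scheme $\sum_{k=0}^{q}\varphi_{q-k}m_1^{n+1-k}=0$ satisfied by the conserved moment $m_1$. Notation: $\boldsymbol e_1$ is the first canonical basis vector; $\boldsymbol u\otimes\boldsymbol v=\boldsymbol u\boldsymbol v^{\mathsf T}$, and $\boldsymbol B\boldsymbol\epsilon\otimes\boldsymbol e_1=(\boldsymbol B\boldsymbol\epsilon)\boldsymbol e_1^{\mathsf T}$. The characteristic polynomial of $\boldsymbol C\in\mathcal{M}_r(\mathcal{R})$ over a commutative ring $\mathcal{R}$ is $\chi_{\boldsymbol C}=(-1)^r\det(\boldsymbol C-X\boldsymbol I)\in\mathcal{R}[X]$. *)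

(* Defs.v *)
From HB Require Import structures.
From mathcomp Require Import all_boot all_order all_algebra.
From mathcomp Require Import boolp classical_sets functions reals.

Set Implicit Arguments.
Unset Strict Implicit.
Unset Printing Implicit Defensive.

Import Order.TTheory GRing.Theory Num.Theory.
Local Open Scope ring_scope.

Section Lattice.
Variables (R : realType) (d : nat) (dx : R).

Definition lattice_pt (z : 'rV[int]_d) : 'rV[R]_d := dx *: map_mx intr z.

Definition lattice_pred : {pred 'rV[R]_d} :=
  fun x => `[< exists z : 'rV[int]_d, x = lattice_pt z >].

Lemma lattice_pred_zmod : zmod_closed lattice_pred.
Proof.
split; first by apply/asboolP; exists 0; rewrite /lattice_pt map_mx0 scaler0.
move=> _ _ /asboolP[z ->] /asboolP[w ->]; apply/asboolP; exists (z - w).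
by rewrite /lattice_pt map_mxB scalerBr.
Qed.

HB.instance Definition _ :=
  GRing.isZmodClosed.Build 'rV[R]_d lattice_pred lattice_pred_zmod.

Record lattice := Lattice {
  lattice_val :> 'rV[R]_d;
  lattice_valP : lattice_val \in lattice_pred }.

HB.instance Definition _ := [isSub for lattice_val].
HB.instance Definition _ := [Choice of lattice by <:].
HB.instance Definition _ := [SubChoice_isSubZmodule of lattice by <:].

Lemma lattice_ptP z : lattice_pt z \in lattice_pred.
Proof. by apply/asboolP; exists z. Qed.

Definition to_lattice (z : 'rV[int]_d) : lattice := Lattice (lattice_ptP z).

Lemma to_latticeD z w : to_lattice (z + w) = to_lattice z + to_lattice w.
Proof. by apply: val_inj; rewrite /= /lattice_pt map_mxD scalerDr. Qed.

Lemma to_lattice0 : to_lattice 0 = 0.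
Proof. by apply: val_inj; rewrite /= /lattice_pt map_mx0 scaler0. Qed.

End Lattice.

(* R^o only serves to let R act on lattice functions by scaling. *)
Notation lfun R d dx := (@lattice R d dx -> R^o).

Section Shifts.
Variables (R : realType) (d : nat) (dx : R).
Local Notation F := (lfun R d dx).
Implicit Types (z w : 'rV[int]_d) (f g : F).

Definition shift_fun z : F -> F := fun f x => f (x - to_lattice dx z).

Lemma shift_fun0 : shift_fun 0 = id.
Proof.
by apply/funext => f; apply/funext => x; rewrite /shift_fun to_lattice0 subr0.
Qed.

Lemma shift_funD z w : shift_fun (z + w) = shift_fun z \o shift_fun w.
Proof.
apply/funext => f; apply/funext => x.
by rewrite /shift_fun /= to_latticeD opprD addrA.
Qed.

Definition shift_comb (s : seq (R * 'rV[int]_d)) : F -> F :=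
  \sum_(p <- s) p.1 *: shift_fun p.2.

Lemma shift_combE s f x :
  shift_comb s f x = \sum_(p <- s) p.1 * f (x - to_lattice dx p.2).
Proof. by rewrite /shift_comb !fct_sumE. Qed.

Lemma shift_comb_nil : shift_comb [::] = 0.
Proof. by rewrite /shift_comb big_nil. Qed.

Lemma shift_comb_cons a z s :
  shift_comb ((a, z) :: s) = a *: shift_fun z + shift_comb s.
Proof. by rewrite /shift_comb big_cons. Qed.

Lemma shift_comb_linear s : linear (shift_comb s).
Proof.
move=> a f g; apply/funext => x.
rewrite [RHS]/((a * shift_comb s f x : R) + (shift_comb s g x : R) : R).
rewrite !shift_combE mulr_sumr -[RHS]big_split; apply: eq_bigr => p _ /=.
by rewrite [X in _ * X = _]/(a * f _ + g _ : R) mulrDr mulrCA.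
Qed.

Definition fd_pred : {pred F -> F} :=
  fun D => `[< exists s, D = shift_comb s >].

Lemma fd_pred_submod : submod_closed fd_pred.
Proof.
split; first by apply/asboolP; exists [::]; rewrite shift_comb_nil.
move=> a _ _ /asboolP[s ->] /asboolP[t ->]; apply/asboolP.
exists ([seq (a * p.1, p.2) | p <- s] ++ t).
rewrite /shift_comb big_cat big_map scaler_sumr; congr (_ + _).
by apply: eq_bigr => p _; rewrite scalerA.
Qed.

HB.instance Definition _ :=
  GRing.isSubmodClosed.Build R (F -> F) fd_pred fd_pred_submod.

Lemma fd_pred_shift z : shift_fun z \in fd_pred.
Proof.
apply/asboolP; exists [:: (1, z)].
by rewrite shift_comb_cons shift_comb_nil scale1r addr0.
Qed.

Lemma shift_comb_comp s t :
  shift_comb s \o shift_comb t =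
  shift_comb [seq (p.1 * r.1, p.2 + r.2) | p <- s, r <- t].
Proof.
apply/funext => f; apply/funext => x.
rewrite /= shift_combE shift_combE big_allpairs_dep /=.
apply: eq_bigr => p _; rewrite shift_combE mulr_sumr; apply: eq_bigr => r _.
by rewrite mulrA to_latticeD opprD addrA.
Qed.

Lemma fd_pred_comp D E : D \in fd_pred -> E \in fd_pred -> D \o E \in fd_pred.
Proof.
move=> /asboolP[s ->] /asboolP[t ->]; apply/asboolP.
by rewrite shift_comb_comp; eexists.
Qed.

Lemma fd_pred_compC D E : D \in fd_pred -> E \in fd_pred -> D \o E = E \o D.
Proof.
move=> /asboolP[s ->] /asboolP[t ->].
apply/funext => f; apply/funext => x; rewrite /= !shift_combE.
under eq_bigr do rewrite shift_combE mulr_sumr.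
under [RHS]eq_bigr do rewrite shift_combE mulr_sumr.
rewrite exchange_big; apply: eq_bigr => r _; apply: eq_bigr => p _.
by rewrite mulrCA addrAC.
Qed.

Lemma fd_pred_linear D : D \in fd_pred -> linear D.
Proof. by move=> /asboolP[s ->]; exact: shift_comb_linear. Qed.

Record fd := Fd { fd_val :> F -> F; fd_valP : fd_val \in fd_pred }.

HB.instance Definition _ := [isSub for fd_val].
HB.instance Definition _ := [Choice of fd by <:].
HB.instance Definition _ := [SubChoice_isSubZmodule of fd by <:].
HB.instance Definition _ := [SubZmodule_isSubLmodule of fd by <:].

Definition shift z : fd := Fd (fd_pred_shift z).

Definition fd_mul (D E : fd) : fd := Fd (fd_pred_comp (fd_valP D) (fd_valP E)).

Let fd_mulA : associative fd_mul.
Proof. by move=> D E G; apply: val_inj. Qed.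

Let fd_mulC : commutative fd_mul.
Proof.
by move=> D E; apply: val_inj; exact: (fd_pred_compC (fd_valP D) (fd_valP E)).
Qed.

Let fd_mul1 : left_id (shift 0) fd_mul.
Proof. by move=> D; apply: val_inj; rewrite /= shift_fun0. Qed.

Let fd_mulDl : left_distributive fd_mul +%R.
Proof. by move=> D E G; apply: val_inj. Qed.

Let fd_1neq0 : shift 0 != 0.
Proof.
apply/eqP => /(congr1 val) /= /(congr1 (fun D => D (cst 1) 0)) /eqP.
by rewrite [X in X == _]/(1 : R) [X in _ == X]/(0 : R) oner_eq0.
Qed.

(* The product of fd is the composition of operators, its unit is T^0 = id. *)
HB.instance Definition _ := GRing.Zmodule_isComNzRing.Build fd
  fd_mulA fd_mulC fd_mul1 fd_mulDl fd_1neq0.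

Let fd_scalerAl (a : R) (D E : fd) : a *: (D * E) = (a *: D) * E.
Proof. by apply: val_inj. Qed.

HB.instance Definition _ := GRing.Lmodule_isLalgebra.Build R fd fd_scalerAl.
HB.instance Definition _ := GRing.Lalgebra_isComAlgebra.Build R fd.

Lemma fd_mulE (D E : fd) f : (D * E) f = D (E f).
Proof. by []. Qed.

Lemma fd_addE (D E : fd) f x : (D + E) f x = D f x + E f x.
Proof. by []. Qed.

Lemma fd_scaleE (a : R) (D : fd) f x : (a *: D) f x = a * D f x.
Proof. by []. Qed.

Lemma fd_algE (a : R) f x : (a%:A : fd) f x = a * f x.
Proof.
rewrite fd_scaleE; congr (_ * _).
by rewrite -[RHS](congr1 (fun D : F -> F => D f x) shift_fun0).
Qed.

Lemma shiftD z w : shift (z + w) = shift z * shift w.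
Proof. by apply: val_inj; exact: shift_funD. Qed.

(* The shifts are linearly independent, so fd is the group ring R[Z^d]. *)
Lemma shift_free (zs : seq 'rV[int]_d) (a : 'rV[int]_d -> R) :
  dx != 0 -> uniq zs -> \sum_(z <- zs) a z *: shift z = 0 ->
  {in zs, forall z, a z = 0}.
Proof.
move=> dx0 zsU az0 z zzs.
have toK w w' : to_lattice dx w = to_lattice dx w' -> w = w'.
  move=> /(congr1 val) /= /(scalerI dx0) /matrixP e.
  by apply/matrixP => i j; apply: (@intr_inj R); have := e i j; rewrite !mxE.
pose delta : F := fun x => (x == 0)%:R.
have dE w : (a w *: shift w) delta (to_lattice dx z) = a w * (z == w)%:R.
  rewrite fd_scaleE; congr (_ * _); rewrite [LHS]/(_ - _ == 0)%:R subr_eq0.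
  by congr (nat_of_bool _)%:R; apply/eqP/eqP => [/toK|->].
have := congr1 (fun D : fd => D delta (to_lattice dx z)) az0.
rewrite -[LHS]/(val (\sum_(w <- zs) a w *: shift w) delta (to_lattice dx z)).
rewrite raddf_sum !fct_sumE (eq_bigr _ (fun w _ => dE w)).
rewrite (bigD1_seq z) //= eqxx mulr1 big1 ?addr0 // => w wz.
by rewrite eq_sym (negPf wz) mulr0.
Qed.

End Shifts.

Section MatricesOfOperators.
Variables (R : realType) (d : nat) (dx : R).
Local Notation F := (lfun R d dx).
Local Notation D := (fd d dx).

Definition opmx_app (m n : nat) (C : 'M[D]_(m, n)) (v : 'cV[F]_n) : 'cV[F]_m :=
  \col_i \sum_j C i j (v j 0).

Definition real_opmx (m n : nat) (C : 'M[R]_(m, n)) : 'M[D]_(m, n) :=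
  map_mx (in_alg D) C.

End MatricesOfOperators.

Arguments real_opmx {R d} dx {m n} C.

Definition outer (A : pzRingType) (m n : nat) (u : 'cV[A]_m) (v : 'cV[A]_n) :
  'M[A]_(m, n) := u *m v^T.

Definition e1 (A : pzRingType) (q : nat) : 'cV[A]_q.+1 := delta_mx ord0 0.
Arguments e1 {A q}.

(* char_poly is det (X I - C). *)
Lemma char_poly_sign (A : comNzRingType) (r : nat) (C : 'M[A]_r) :
  char_poly C = (-1) ^+ r * \det (map_mx polyC C - 'X%:M).
Proof. by rewrite -detZ scaleN1r opprB. Qed.

(* The number of velocities is q.+1. *)
Section Scheme.
Variables (R : realType) (d : nat) (dx : R) (q : nat).
Local Notation F := (lfun R d dx).
Local Notation D := (fd d dx).

Definition transport (c : 'I_q.+1 -> 'rV[int]_d) (M : 'M[R]_q.+1) :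
  'M[D]_q.+1 :=
  real_opmx dx M *m diag_mx (\row_j shift dx (c j)) *m real_opmx dx (invmx M).

Definition lbm_A c (M : 'M[R]_q.+1) (s : 'rV[R]_q.+1) : 'M[D]_q.+1 :=
  transport c M *m (1%:M - real_opmx dx (diag_mx s)).

Definition lbm_B c (M : 'M[R]_q.+1) (s : 'rV[R]_q.+1) : 'M[D]_q.+1 :=
  transport c M *m real_opmx dx (diag_mx s).

Definition equilibrium (meq : R -> 'cV[R]_q.+1) (m : 'cV[F]_q.+1) :
  'cV[F]_q.+1 := \col_i (fun x => meq (m ord0 0 x) i 0).

Definition lbm_step c M s meq (m : 'cV[F]_q.+1) : 'cV[F]_q.+1 :=
  opmx_app (lbm_A c M s) m + opmx_app (lbm_B c M s) (equilibrium meq m).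

Definition fd_amplification (A B : 'M[D]_q.+1) (eps : 'cV[R]_q.+1) :
  {poly D} :=
  let gamma k := (char_poly A)`_k in
  let phi k := gamma k -
    (\sum_(0 <= l < q.+1 - k)
       gamma (k + 1 + l)%N *: (A ^+ l *m outer (B *m real_opmx dx eps) e1)
     : 'M[D]_q.+1) ord0 ord0 in
  'X^(q.+1) + \sum_(k < q.+1) phi k *: 'X^k.

End Scheme.

(* Main.v *)
(** With Q_k the coefficient of X^k in adj(X I - A), comparing coefficients in
    (X I - A) adj(X I - A) = chi_A(X) I gives Q_k = gamma_(k+1) I + A Q_(k+1),
    hence Q_k = sum_l gamma_(k+1+l) A^l. Adding the matrix u e_1^T to A changes
    only the first column of X I - A, and expanding along that column gives
    chi_(A + u e_1^T) = chi_A - (adj(X I - A) u)_1. *)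
Require Import Defs.
From mathcomp Require Import all_boot all_order all_algebra.
From mathcomp Require Import boolp classical_sets functions reals.

Import Order.TTheory GRing.Theory Num.Theory.
Local Open Scope ring_scope.

Section RankOnePerturbation.
Set Implicit Arguments.
Unset Strict Implicit.
Variables (K : comNzRingType) (q : nat).
Implicit Types (A : 'M[K]_q.+1) (u : 'cV[K]_q.+1).

(** The matrix Q_k: adj(X I - A) is the sum of the Q_k X^k. *)
Definition adj_coef A k : 'M[K]_q.+1 :=
  map_mx (coefp k) (\adj (char_poly_mx A)).

Lemma adj_coefS A k :
  adj_coef A k = ((char_poly A)`_k.+1)%:M + A * adj_coef A k.+1.
Proof.
have /matrixP adjE := mul_mx_adj (char_poly_mx A).
(* Degree k+1 is read off because X shifts Q_k up to it, while the constant matrix A leaves Q_(k+1)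
   in place. *)
apply/matrixP => i j; have := congr1 (coefp k.+1) (adjE i j).
rewrite /char_poly_mx mulmxBl mul_scalar_mx !mxE /= coefB coefXM /=.
rewrite coef_sum coefMn => /eqP; rewrite subr_eq => /eqP ->; congr (_ + _).
by apply: eq_bigr => l _; rewrite !mxE coefCM.
Qed.

(** Unrolls the recursion m times, keeping the remainder so that no degree bound is needed yet. *)
Lemma adj_coef_iter A k m :
  adj_coef A k = \sum_(0 <= l < m) (char_poly A)`_(k + 1 + l) *: A ^+ l
                 + A ^+ m * adj_coef A (k + m).
Proof.
elim: m => [|m IHm]; first by rewrite big_geq // add0r addn0 expr0 mul1r.
rewrite big_nat_recr //= {1}IHm adj_coefS mulrDr -addrA.
rewrite [X in _ + (X + _) = _]mul_mx_scalar mulrA -exprSr.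
by rewrite addn1 addSn addnS.
Qed.

(** The entries of the adjugate are finitely many polynomials; any common bound on their sizes will
    do to kill the remainder. *)
Lemma adj_coef_eq0 A : exists m, forall k, (m <= k)%N -> adj_coef A k = 0.
Proof.
exists (\max_i \max_j size (\adj (char_poly_mx A) i j)) => k le_mk.
apply/matrixP => i j; rewrite [LHS]mxE [RHS]mxE /=; apply: nth_default.
apply: leq_trans le_mk.
by rewrite (leq_trans _ (leq_bigmax i)) // (leq_bigmax j).
Qed.

Lemma adj_coefE A k :
  adj_coef A k =
  \sum_(0 <= l < q.+1 - k) (char_poly A)`_(k + 1 + l) *: A ^+ l.
Proof.
have [m adj0] := adj_coef_eq0 A.
(* The extra m steps make the remainder vanish; the terms they add carry coefficients of chi_A
   beyond its degree q+1, so they are zero. *)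
rewrite (adj_coef_iter A k (q.+1 - k + m)) adj0; last first.
  by rewrite addnA leq_addl.
rewrite mulr0 addr0 (big_cat_nat (n := q.+1 - k)) ?leq_addr //=.
rewrite [X in _ + X]big_nat_cond [X in _ + X]big1 ?addr0 //.
move=> l /andP[/andP[le_l _] _].
by rewrite nth_default ?scale0r // size_char_poly addn1 addSn ltnS -leq_subLR.
Qed.

Lemma char_poly_add_col1 A u :
  char_poly (A + outer u e1) =
  char_poly A - (\adj (char_poly_mx A) *m map_mx polyC u) ord0 0.
Proof.
rewrite /char_poly !(expand_det_col _ ord0) mxE -sumrB.
apply: eq_bigr => i _; rewrite [\adj _ _ _]mxE.
(* These minors omit the first column, the only one where the two matrices differ. *)
have -> : cofactor (char_poly_mx (A + outer u e1)) i ord0 =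
          cofactor (char_poly_mx A) i ord0.
  rewrite /cofactor; congr (_ * \det _); apply/matrixP => k l.
  by rewrite !mxE big_ord1 !mxE /= mulr0 addr0.
rewrite [cofactor _ _ _ * _]mulrC -mulrBl; congr (_ * _).
by rewrite !mxE big_ord1 !mxE /= mulr1 polyCD opprD addrA.
Qed.

(** For u = B eps and k at most q, the right side is the coefficient [phi k] of
    [fd_amplification]. *)
Lemma coef_char_poly_add_col1 A u k :
  (char_poly (A + outer u e1))`_k =
  (char_poly A)`_k -
  (\sum_(0 <= l < q.+1 - k)
     (char_poly A)`_(k + 1 + l) *: (A ^+ l *m outer u e1) : 'M_q.+1) ord0 ord0.
Proof.
rewrite char_poly_add_col1 coefB; congr (_ - _).
under eq_bigr do rewrite scalemxAl.
(* The sum is Q_k u e_1^T, whose top left entry is the first entry of Q_k u. *)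
rewrite -mulmx_suml -adj_coefE /outer mulmxA [in RHS]mxE big_ord1.
rewrite [e1^T _ _]mxE [e1 _ _]mxE mulr1 [in RHS]mxE [in LHS]mxE coef_sum.
apply: eq_bigr => i _.
by rewrite [map_mx _ u _ _]mxE coefMC [adj_coef _ _ _ _]mxE.
Qed.

End RankOnePerturbation.

Lemma fd_amplificationE (R : realType) (d : nat) (dx : R) (q : nat)
    (A B : 'M[fd d dx]_q.+1) (eps : 'cV[R]_q.+1) :
  fd_amplification A B eps =
  char_poly (A + outer (B *m real_opmx dx eps) e1).
Proof.
set C := A + _.
rewrite /fd_amplification.
under eq_bigr do rewrite -coef_char_poly_add_col1.
(* The leading term, which [fd_amplification] sets apart, matches since chi_C is monic of degree
   q+1. *)
have := char_poly_monic C; rewrite monicE lead_coefE size_char_poly /= => /eqP Cq.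
rewrite -[RHS]coefK size_char_poly poly_def [RHS]big_ord_recr /= Cq scale1r.
by rewrite addrC.
Qed.

Section OperatorMatrices.
Set Implicit Arguments.
Unset Strict Implicit.
Variables (R : realType) (d : nat) (dx : R).
Local Notation F := (lfun R d dx).
Local Notation D := (fd d dx).

Lemma fd_val_sum (I : Type) (r : seq I) (P : pred I) (E : I -> D) (f : F) :
  (\sum_(i <- r | P i) E i) f = \sum_(i <- r | P i) E i f.
Proof. exact: (big_morph (fun E : D => E f)). Qed.

Lemma fd_valD (E : D) (f g : F) : E (f + g) = E f + E g.
Proof. by have := fd_pred_linear (fd_valP E) 1 f g; rewrite !scale1r. Qed.

Lemma fd_val0 (E : D) : E 0 = 0.
Proof. by apply: (addrI (E 0)); rewrite -fd_valD !addr0. Qed.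

Lemma fd_sumr (E : D) (I : Type) (r : seq I) (P : pred I) (f : I -> F) :
  E (\sum_(i <- r | P i) f i) = \sum_(i <- r | P i) E (f i).
Proof. by apply: (big_morph E); [exact: fd_valD | exact: fd_val0]. Qed.

Lemma opmx_appD (m n : nat) (C E : 'M[D]_(m, n)) (v : 'cV[F]_n) :
  opmx_app (C + E) v = opmx_app C v + opmx_app E v.
Proof.
apply/matrixP => i j; rewrite !mxE -big_split.
by apply: eq_bigr => k _; rewrite mxE.
Qed.

(** The product in [fd] is composition, and its operators are additive, so the two sums can be
    exchanged. *)
Lemma opmx_appM (m n r : nat) (C : 'M[D]_(m, n)) (E : 'M[D]_(n, r))
    (v : 'cV[F]_r) :
  opmx_app (C *m E) v = opmx_app C (opmx_app E v).
Proof.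
apply/matrixP => i j; rewrite !mxE.
under eq_bigr do rewrite mxE fd_val_sum.
rewrite exchange_big; apply: eq_bigr => k _.
by rewrite mxE fd_sumr.
Qed.

Lemma equilibrium_linear (q : nat) (meq : R -> 'cV[R]_q.+1)
    (eps : 'cV[R]_q.+1) (m : 'cV[F]_q.+1) :
  (forall u, meq u = u *: eps) ->
  equilibrium meq m = opmx_app (outer (real_opmx dx eps) e1) m.
Proof.
move=> meqE; apply/matrixP => i j; rewrite !mxE.
have outerE k :
    outer (real_opmx dx eps) e1 i k = (eps i 0)%:A * (k == ord0)%:R :> D.
  by rewrite !mxE big_ord1 !mxE andbT.
(* Only the first column of eps e_1^T is nonzero, so only the conserved moment survives. *)
rewrite (bigD1 ord0) //= big1 ?addr0 => [|k k0]; last first.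
  by rewrite outerE (negPf k0) mulr0.
by apply/funext => x; rewrite outerE mulr1 fd_algE meqE mxE mulrC.
Qed.

End OperatorMatrices.

(** The size [p.+2] encodes q at least 2. The first two claims tie [C] to the scheme that the
    polynomial identity is about. *)
Theorem proposition12 (R : realType) (d : nat) (dx : R) (p : nat)
    (c : 'I_p.+2 -> 'rV[int]_d) (M : 'M[R]_p.+2) (s : 'rV[R]_p.+2)
    (meq : R -> 'cV[R]_p.+2) (eps : 'cV[R]_p.+2)
    (hd : (1 <= d <= 3)%N) (hdx : 0 < dx)
    (hM : M \in unitmx)
    (hs0 : s 0 ord0 = 0)
    (hs : forall i, i != ord0 -> 0 < s 0 i <= 2)
    (hmeq : forall u, meq u = u *: eps) :
  let A := lbm_A dx c M s in
  let B := lbm_B dx c M s in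
  let C := A + outer (B *m real_opmx dx eps) e1 in
  [/\ forall m : 'cV[lfun R d dx]_p.+2,
        equilibrium meq m = opmx_app (outer (real_opmx dx eps) e1) m,
      forall m : 'cV[lfun R d dx]_p.+2,
        lbm_step c M s meq m = opmx_app C m
    & fd_amplification A B eps = char_poly C].
Proof.
move=> A B C; split=> [m | m |].
- exact: equilibrium_linear.
(* A m + B ((eps e_1^T) m) is gathered into the action of one matrix; associativity turns B (eps
   e_1^T) into (B eps) e_1^T. *)
- rewrite /lbm_step (equilibrium_linear _ hmeq) -opmx_appM -opmx_appD.
  by rewrite /C /outer mulmxA.
- exact: fd_amplificationE.
Qed.
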